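(* Let $p$ be a prime, $\alpha>0$, $\gamma>0$, $u_0\in\mathbb{R}$, and let $f:p^{\mathbb{Z}}\times\mathbb{R}\to\mathbb{R}$. Suppose there are constants $M,F$ such that for all $0\ne t\in\mathbb{Q}_p$ and all $x,y\in\mathbb{R}$ $$|f(|t|_p,x)|\le M,\qquad |f(|t|_p,x)-f(|t|_p,y)|\le F|x-y|,$$ and suppose $\gamma<\min(1,\alpha)$. Then the Cauchy problem $$|t|_p^{\gamma}(D^{\alpha}u)(|t|_p)=f(|t|_p,u(|t|_p)),\quad 0\ne t\in\mathbb{Q}_p,\qquad u(0)=u_0,$$ has a unique local mild solution. That is: for a sufficiently negative $N\in\mathbb{Z}$ there is a radial real-valued function $u=u(|t|_p)$ defined for $|t|_p\le p^N$ which satisfies $$u(|t|_p)=u_0+I^{\alpha}\left[|\cdot|_p^{-\gamma}f(|\cdot|_p,u(|\cdot|_p))\right](|t|_p)\qquad (|t|_p\le p^N),$$ and for any other radial real-valued solution $\overline{u}(|t|_p)$ of this integral equation, defined on some ball centred at $0$, there is an integer $K\le N$ such that $\overline{u}(|t|_p)=u(|t|_p)$ for all $|t|_p\le p^K$.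
   Context: $\mathbb{Q}_p$ is the field of $p$-adic numbers with norm $|\cdot|_p$; $p^{\mathbb{Z}}=\{p^k:k\in\mathbb{Z}\}$ is the set of nonzero values of $|\cdot|_p$; $dy$ is Haar measure on $\mathbb{Q}_p$ normalized so that the unit ball has measure $1$. A radial function is a function of $|t|_p$ only. For a function $\varphi$ the $p$-adic fractional integral is $$(I^{\alpha}\varphi)(x)=\frac{1-p^{-\alpha}}{1-p^{\alpha-1}}\int_{|y|_p\le|x|_p}\big(|x-y|_p^{\alpha-1}-|y|_p^{\alpha-1}\big)\varphi(y)\,dy\quad(\alpha\ne1),$$ $$(I^{1}\varphi)(x)=\frac{1-p}{p\log p}\int_{|y|_p\le|x|_p}\big(\log|x-y|_p-\log|y|_p\big)\varphi(y)\,dy,$$ whenever the integral converges absolutely; at $x=0$ the domain of integration has measure zero and the value is $0$. $D^\alpha$ is the Vladimirov operator $(D^{\alpha}\varphi)(t)=\frac{1-p^{\alpha}}{1-p^{-\alpha-1}}\int_{\mathbb{Q}_p}|y|_p^{-\alpha-1}[\varphi(t-y)-\varphi(t)]\,dy$. A mild solution of the Cauchy problem is, by definition, a solution of the displayed integral equation. *)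

(* Defs.v *)
From HB Require Import structures.
From mathcomp Require Import all_boot all_order all_algebra.
From mathcomp Require Import ring.
From mathcomp Require Import all_classical all_reals all_analysis.
Import Order.TTheory GRing.Theory Num.Theory.
Import numFieldNormedType.Exports.
Set Implicit Arguments.
Unset Strict Implicit.
Unset Printing Implicit Defensive.
Local Open Scope ring_scope.

(* For a non-prime p, [logn p] is 0 and this is the trivial absolute value, so
   the construction of [Qp p] needs no primality hypothesis. *)
Definition rat_padic_norm (p : nat) (q : rat) : rat :=
  if q == 0 then 0
  else (p%:R : rat) ^ ((logn p `|denq q|)%:Z - (logn p `|numq q|)%:Z).

Section RatPadicNorm.
Variable p : nat.
Local Notation nrm := (rat_padic_norm p).

Lemma rat_padic_norm0 : nrm 0 = 0.
Proof. by rewrite /rat_padic_norm eqxx. Qed.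

Lemma rat_padic_norm_frac (a b : int) : a != 0 -> b != 0 ->
  nrm (a%:~R / b%:~R) = (p%:R : rat) ^ ((logn p `|b|)%:Z - (logn p `|a|)%:Z).
Proof.
move=> a0 b0; set x : rat := a%:~R / b%:~R.
have x0 : x != 0 by rewrite mulf_neq0 ?invr_eq0 ?intr_eq0.
rewrite /rat_padic_norm (negPf x0); congr (_ ^ _).
have E : numq x * b = a * denq x.
  apply/eqP; rewrite -(eqr_int rat) !intrM numqE.
  by rewrite /x mulrAC divfK ?intr_eq0.
have /(congr1 absz) := E; rewrite !abszM => /(congr1 (logn p)).
rewrite !lognM ?absz_gt0 ?numq_eq0 ?denq_neq0 // => H.
by apply/eqP; rewrite subr_eq addrAC eq_sym subr_eq -!PoszD addnC H addnC.
Qed.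

Lemma rat_padic_norm_prime_or : prime p \/ forall q, nrm q = (q != 0)%:R.
Proof.
case: (boolP (prime p)) => pp; [by left|right => q].
have l0 m : logn p m = 0%N by rewrite lognE (negPf pp).
by rewrite /rat_padic_norm !l0 subrr expr0z; case: eqP.
Qed.

Lemma rat_padic_norm_ge0 q : 0 <= nrm q.
Proof. by rewrite /rat_padic_norm; case: eqP => // _; apply: exprz_ge0. Qed.

Lemma rat_padic_norm_eq0 q : (nrm q == 0) = (q == 0).
Proof.
case: rat_padic_norm_prime_or => [pp|->]; last by rewrite pnatr_eq0; case: (q == 0).
rewrite /rat_padic_norm; case: (q =P 0) => [_|_]; first exact: eqxx.
by apply/negbTE/expfz_neq0; rewrite pnatr_eq0 -lt0n prime_gt0.
Qed.

Lemma rat_padic_norm_gt0 q : (0 < nrm q) = (q != 0).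
Proof. by rewrite lt0r rat_padic_norm_eq0 rat_padic_norm_ge0 andbT. Qed.

Lemma rat_padic_normM x y : nrm (x * y) = nrm x * nrm y.
Proof.
case: (x =P 0) => [->|/eqP x0]; first by rewrite mul0r rat_padic_norm0 mul0r.
case: (y =P 0) => [->|/eqP y0]; first by rewrite mulr0 rat_padic_norm0 mulr0.
case: rat_padic_norm_prime_or => [pp|H]; last first.
  by rewrite !H mulf_neq0 // x0 y0 mulr1.
rewrite -{1}(divq_num_den x) -{1}(divq_num_den y) mulf_div -!intrM.
rewrite rat_padic_norm_frac ?mulf_neq0 ?numq_eq0 ?denq_neq0 //.
rewrite /rat_padic_norm (negPf x0) (negPf y0) -expfzDr; last first.
  by rewrite pnatr_eq0 -lt0n prime_gt0.
rewrite !abszM !lognM ?absz_gt0 ?numq_eq0 ?denq_neq0 //.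
by congr (_ ^ _); rewrite !PoszD opprD addrACA.
Qed.

Lemma rat_padic_norm1 : nrm 1 = 1.
Proof.
by rewrite /rat_padic_norm /= !logn1 subrr.
Qed.

Lemma rat_padic_normN x : nrm (- x) = nrm x.
Proof.
by rewrite /rat_padic_norm oppr_eq0 numqN denqN abszN.
Qed.

Lemma rat_padic_normV x : nrm x^-1 = (nrm x)^-1.
Proof.
case: (x =P 0) => [->|/eqP x0]; first by rewrite !(invr0, rat_padic_norm0).
have n0 : nrm x != 0 by rewrite rat_padic_norm_eq0.
by apply: (mulfI n0); rewrite -rat_padic_normM !mulfV // rat_padic_norm1.
Qed.

Lemma rat_padic_normD x y : nrm (x + y) <= Num.max (nrm x) (nrm y).
Proof.
case: (x =P 0) => [->|/eqP x0]; first by rewrite add0r le_max lexx orbT.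
case: (y =P 0) => [->|/eqP y0]; first by rewrite addr0 le_max lexx.
case: (x + y =P 0) => [->|/eqP xy0].
  by rewrite rat_padic_norm0 le_max rat_padic_norm_ge0.
case: rat_padic_norm_prime_or => [pp|H]; last first.
  by rewrite !H x0 y0 xy0 le_max lexx.
set d := denq x * denq y; set a := numq x * denq y; set b := numq y * denq x.
have d0 : d != 0 by rewrite mulf_neq0 ?denq_neq0.
have a0 : a != 0 by rewrite mulf_neq0 ?denq_neq0 ?numq_eq0.
have b0 : b != 0 by rewrite mulf_neq0 ?denq_neq0 ?numq_eq0.
have ex : x = a%:~R / d%:~R.
  rewrite /a /d !intrM -mulf_div divq_num_den divff ?mulr1 //.
  by rewrite intr_eq0 denq_neq0.
have ey : y = b%:~R / d%:~R.
  rewrite /b /d [denq x * _]mulrC !intrM -mulf_div divq_num_den divff ?mulr1 //.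
  by rewrite intr_eq0 denq_neq0.
have exy : x + y = (a + b)%:~R / d%:~R by rewrite intrD mulrDl -ex -ey.
have ab0 : a + b != 0.
  by apply: contraNneq xy0; rewrite exy => ->; rewrite mul0r.
have p1 : 1 <= (p%:R : rat) by rewrite ler1n prime_gt0.
rewrite exy ex ey !rat_padic_norm_frac //.
have la : forall k, (k <= logn p `|a|)%N -> (k <= logn p `|b|)%N ->
   (k <= logn p `|(a + b)%R|)%N.
  move=> k; rewrite -!pfactor_dvdn ?absz_gt0 // => ka kb.
  have : ((p ^ k)%:Z %| a + b)%Z by apply: rpredD.
  by [].
rewrite le_max; case: (leqP (logn p `|a|) (logn p `|b|)) => h.
  apply/orP; left; apply: ler_weXz2l => //.
  by rewrite lerD2l lerN2 lez_nat; apply: la.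
apply/orP; right; apply: ler_weXz2l => //.
by rewrite lerD2l lerN2 lez_nat; apply: la => //; exact: ltnW.
Qed.

End RatPadicNorm.

Definition padic_cauchy (p : nat) (u : nat -> rat) : Prop :=
  forall e : rat, 0 < e -> exists N : nat, forall m n : nat,
    (N <= m)%N -> (N <= n)%N -> rat_padic_norm p (u m - u n) < e.

Definition padic_null (p : nat) (u : nat -> rat) : Prop :=
  forall e : rat, 0 < e -> exists N : nat, forall n : nat,
    (N <= n)%N -> rat_padic_norm p (u n) < e.

Section CauchySequences.
Variable p : nat.
Local Notation nrm := (rat_padic_norm p).

Lemma rat_padic_normD_lt x y e : nrm x < e -> nrm y < e -> nrm (x + y) < e.
Proof.
by move=> xe ye; apply: le_lt_trans (rat_padic_normD p x y) _; rewrite gt_max xe.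
Qed.

Lemma rat_padic_normB_lt x y e : nrm x < e -> nrm y < e -> nrm (x - y) < e.
Proof. by move=> xe ye; apply: rat_padic_normD_lt; rewrite ?rat_padic_normN. Qed.

Lemma padic_cauchy_bounded u : padic_cauchy p u ->
  exists2 B, 0 < B & exists N, forall n, (N <= n)%N -> nrm (u n) < B.
Proof.
move=> /(_ 1 ltr01)[N uN]; exists (1 + nrm (u N)).
  by rewrite ltr_pwDl // rat_padic_norm_ge0.
exists N => n Nn; rewrite -(subrK (u N) (u n)); apply: rat_padic_normD_lt.
  by rewrite ltr_wpDr ?rat_padic_norm_ge0 // uN.
by rewrite ltrDr.
Qed.

Lemma padic_nullM u v : padic_cauchy p u -> padic_null p v ->
  padic_null p (u * v).
Proof.
move=> /padic_cauchy_bounded[B B0 [N uN]] v0 e e0.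
have [N' vN'] := v0 (e / B) (divr_gt0 e0 B0).
exists (maxn N N') => n; rewrite geq_max => /andP[Nn N'n].
rewrite rat_padic_normM -(divfK (lt0r_neq0 B0) e) mulrC.
by apply: ltr_pM; rewrite ?rat_padic_norm_ge0 ?uN ?vN'.
Qed.

Lemma padic_nullB u v : padic_null p u -> padic_null p v ->
  padic_null p (u - v).
Proof.
move=> u0 v0 e e0; have [N uN] := u0 e e0; have [N' vN'] := v0 e e0.
exists (maxn N N') => n; rewrite geq_max => /andP[Nn N'n].
by apply: rat_padic_normB_lt; [exact: uN|exact: vN'].
Qed.

Definition padic_cauchyb : {pred nat -> rat} :=
  fun u => `[< padic_cauchy p u >].

Lemma padic_cauchyb_subring : subring_closed padic_cauchyb.
Proof.
split.
- apply/asboolP => e e0; exists 0%N => m n _ _.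
  by rewrite subrr rat_padic_norm0.
- move=> u v /asboolP uc /asboolP vc; apply/asboolP => e e0.
  have [N uN] := uc e e0; have [N' vN'] := vc e e0.
  exists (maxn N N') => m n; rewrite !geq_max => /andP[Nm N'm] /andP[Nn N'n].
  rewrite [X in nrm X](_ : _ = (u m - u n) - (v m - v n)); last first.
    by rewrite -[LHS]/((u m - v m) - (u n - v n)); ring.
  by apply: rat_padic_normB_lt; [exact: uN|exact: vN'].
- move=> u v /asboolP uc /asboolP vc; apply/asboolP => e e0.
  have [B B0 [N uN]] := padic_cauchy_bounded uc.
  have [C C0 [N' vN']] := padic_cauchy_bounded vc.
  have [L uL] := uc (e / C) (divr_gt0 e0 C0).
  have [L' vL'] := vc (e / B) (divr_gt0 e0 B0).
  exists (maxn (maxn N N') (maxn L L')) => m n; rewrite !geq_max.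
  move=> /andP[/andP[Nm N'm] /andP[Lm L'm]] /andP[/andP[Nn N'n] /andP[Ln L'n]].
  rewrite [X in nrm X](_ : _ = (u m - u n) * v m + u n * (v m - v n)).
    apply: rat_padic_normD_lt; rewrite rat_padic_normM.
      rewrite -(divfK (lt0r_neq0 C0) e).
      by apply: ltr_pM; rewrite ?rat_padic_norm_ge0 ?uL ?vN'.
    rewrite -(divfK (lt0r_neq0 B0) e) mulrC.
    by apply: ltr_pM; rewrite ?rat_padic_norm_ge0 ?uN ?vL'.
  by rewrite -[LHS]/((u m * v m) - (u n * v n)); ring.
Qed.

HB.instance Definition _ :=
  GRing.isSubringClosed.Build (nat -> rat) padic_cauchyb padic_cauchyb_subring.

Record cauchy_seq := CauchySeq {
  cauchy_val :> nat -> rat;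
  cauchy_valP : cauchy_val \in padic_cauchyb }.

HB.instance Definition _ := [isSub for cauchy_val].
HB.instance Definition _ := [Choice of cauchy_seq by <:].
HB.instance Definition _ := [SubChoice_isSubComNzRing of cauchy_seq by <:].

Definition padic_nullb : {pred cauchy_seq} := fun u => `[< padic_null p u >].

Lemma padic_nullb_ideal : idealr_closed padic_nullb.
Proof.
split.
- by apply/asboolP => e e0; exists 0%N => n _; rewrite rat_padic_norm0.
- by apply/asboolP => /(_ 1 ltr01)[N /(_ N (leqnn N))]; rewrite rat_padic_norm1.
- move=> a u v /asboolP u0 /asboolP v0; apply/asboolP.
  have -> : (a * u + v : cauchy_seq) = a * u - (- v) by rewrite opprK.
  apply: padic_nullB; first by apply: padic_nullM => //; exact/asboolP/cauchy_valP.
  by move=> e /v0[N vN]; exists N => n /vN; rewrite -rat_padic_normN.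
Qed.

HB.instance Definition _ :=
  isIdealr.Build cauchy_seq padic_nullb padic_nullb_ideal.

(* The completion of rat: Cauchy sequences modulo null sequences. *)
Definition Qp := {ideal_quot padic_nullb}.
HB.instance Definition _ := GRing.ComNzRing.on Qp.

Lemma rat_padic_norm_iso x y : nrm (x - y) < nrm y -> nrm x = nrm y.
Proof.
move=> xy; apply/eqP; rewrite eq_le; apply/andP; split.
  rewrite -{1}(subrK y x); apply: le_trans (rat_padic_normD p _ _) _.
  by rewrite ge_max lexx ltW.
have := rat_padic_normD p (y - x) x; rewrite subrK le_max => /orP[|//].
by rewrite -(opprB x y) rat_padic_normN leNgt xy.
Qed.

Lemma padic_cauchy_norm u : padic_cauchy p u -> ~ padic_null p u ->
  exists2 c, 0 < c & exists N, forall n, (N <= n)%N -> nrm (u n) = c.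
Proof.
move=> uc /existsNP[e /not_implyP[e0 /forallNP ue]].
have [N uN] := uc e e0; have /existsNP[k /not_implyP[Nk /negP]] := ue N.
rewrite -leNgt => ek; exists (nrm (u k)); first exact: lt_le_trans ek.
exists N => n Nn; apply: rat_padic_norm_iso.
by apply: lt_le_trans ek; exact: uN.
Qed.

Definition Qp_of (u : cauchy_seq) : Qp := \pi_{ideal_quot padic_nullb}%qT u.
Definition Qp_repr (x : Qp) : cauchy_seq := repr x.

Lemma Qp_reprK x : Qp_of (Qp_repr x) = x.
Proof. exact: reprK. Qed.

Lemma Qp_of_eq u v : (Qp_of u == Qp_of v) = (u - v \in padic_nullb).
Proof. by rewrite (Quotient.idealrBE padic_nullb). Qed.

Lemma Qp_of_is_zmod_morphism : zmod_morphism Qp_of.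
Proof. exact: (rmorphB \pi_{ideal_quot padic_nullb}%qT). Qed.

Lemma Qp_of_is_monoid_morphism : monoid_morphism Qp_of.
Proof.
split; first exact: (rmorph1 \pi_{ideal_quot padic_nullb}%qT).
exact: (rmorphM \pi_{ideal_quot padic_nullb}%qT).
Qed.

HB.instance Definition _ :=
  GRing.isZmodMorphism.Build cauchy_seq Qp Qp_of Qp_of_is_zmod_morphism.
HB.instance Definition _ :=
  GRing.isMonoidMorphism.Build cauchy_seq Qp Qp_of Qp_of_is_monoid_morphism.

Lemma Qp_of_eq0 u : (Qp_of u == 0) = (u \in padic_nullb).
Proof. by rewrite -(rmorph0 Qp_of) Qp_of_eq subr0. Qed.

Lemma Qp_neq0 x : x != 0 -> exists2 c, 0 < c &
  exists N, forall n, (N <= n)%N -> nrm (Qp_repr x n) = c.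
Proof.
rewrite -{1}(Qp_reprK x) Qp_of_eq0 => /asboolP nx.
by apply: padic_cauchy_norm nx; exact/asboolP/cauchy_valP.
Qed.

Lemma Qp_inv_ex x : exists y : Qp, if x == 0 then y = 0 else y * x = 1.
Proof.
case: eqVneq => [_|x0]; first by exists 0.
have [c c0 [N uN]] := Qp_neq0 x0; set u := Qp_repr x in uN *.
have u0 n : (N <= n)%N -> u n != 0.
  by move=> /uN un; rewrite -(rat_padic_norm_eq0 p) un gt_eqF.
have vP : (fun n => (u n)^-1) \in padic_cauchyb.
  have /asboolP uc := cauchy_valP u; apply/asboolP => e e0.
  have [L uL] := uc (e * (c * c)) (mulr_gt0 e0 (mulr_gt0 c0 c0)).
  exists (maxn N L) => m n; rewrite !geq_max => /andP[Nm Lm] /andP[Nn Ln].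
  have -> : (u m)^-1 - (u n)^-1 = (u n - u m) * (u m * u n)^-1.
    by field; rewrite !u0.
  rewrite rat_padic_normM rat_padic_normV rat_padic_normM !uN //.
  by rewrite ltr_pdivrMr ?mulr_gt0 // uL.
exists (Qp_of (CauchySeq vP)); rewrite -[x in _ * x]Qp_reprK -/u.
rewrite -rmorphM -(rmorph1 Qp_of); apply/eqP; rewrite Qp_of_eq.
apply/asboolP => e e0; exists N => n Nn.
rewrite -[X in nrm X]/((u n)^-1 * u n - 1) mulVf ?u0 // subrr.
Qed.

Definition Qp_inv (x : Qp) : Qp := projT1 (cid (Qp_inv_ex x)).

Lemma Qp_mulVf x : x != 0 -> Qp_inv x * x = 1.
Proof. by rewrite /Qp_inv; case: cid => /= y; case: ifP. Qed.

Lemma Qp_inv0 : Qp_inv 0 = 0.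
Proof. by rewrite /Qp_inv; case: cid => /= y; rewrite eqxx. Qed.

HB.instance Definition _ :=
  GRing.ComNzRing_isField.Build Qp Qp_mulVf Qp_inv0.
HB.instance Definition _ := isPointed.Build Qp 0.

Section QpNorm.
Variable R : realType.

Definition Qp_norm (x : Qp) : R :=
  limn (fun n => ratr (nrm (Qp_repr x n)) : R).

Lemma Qp_repr_of (u : cauchy_seq) : padic_null p (cauchy_val (Qp_repr (Qp_of u)) - u).
Proof.
have /eqP := Qp_reprK (Qp_of u).
by rewrite Qp_of_eq => /asboolP.
Qed.

Lemma Qp_norm_of (u : cauchy_seq) c : (exists N, forall n, (N <= n)%N -> nrm (u n) = c) ->
  Qp_norm (Qp_of u) = ratr c.
Proof.
move=> [N uN]; have vu := @Qp_repr_of u.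
set v := Qp_repr (Qp_of u) in vu *.
have c0 : 0 <= c by rewrite -(uN N) // rat_padic_norm_ge0.
apply: cvg_lim => //; apply/cvgrPdist_lt => e e0.
have [cz|cN0] := eqVneq c 0.
  have [q] := rat_in_itvoo e0; rewrite in_itv /= => /andP[].
  rewrite ltr0q => q0 qe; have [L vL] := vu q q0.
  exists (maxn N L) => // n /=; rewrite geq_max => /andP[Nn Ln].
  rewrite cz rmorph0 sub0r normrN ger0_norm ?ler0q ?rat_padic_norm_ge0 //.
  apply: lt_trans qe; rewrite ltr_rat -(subrK (u n) (v n)).
  apply: rat_padic_normD_lt; first exact: vL.
  by rewrite uN // cz.
have cp : 0 < c by rewrite lt0r cN0.
have [L vL] := vu c cp; exists (maxn N L) => // n /=.
rewrite geq_max => /andP[Nn Ln].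
rewrite (@rat_padic_norm_iso (v n) (u n)) ?uN ?subrr ?normr0 //.
exact: vL.
Qed.

Lemma Qp_norm0 : Qp_norm 0 = 0.
Proof.
rewrite -(rmorph0 Qp_of) (@Qp_norm_of 0 0) ?rmorph0 //.
by exists 0%N => n _; exact: rat_padic_norm0.
Qed.

Lemma Qp_norm_repr x c :
  (exists N, forall n, (N <= n)%N -> nrm (Qp_repr x n) = c) ->
  Qp_norm x = ratr c.
Proof. by move=> H; rewrite -(Qp_reprK x); exact: Qp_norm_of. Qed.

Lemma Qp_norm_ge0 x : 0 <= Qp_norm x.
Proof.
have [->|/Qp_neq0[c c0 H]] := eqVneq x 0; first by rewrite Qp_norm0.
by rewrite (Qp_norm_repr H) ler0q ltW.
Qed.

Lemma Qp_norm_eq0 x : (Qp_norm x == 0) = (x == 0).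
Proof.
have [->|/Qp_neq0[c c0 H]] := eqVneq x 0; first by rewrite Qp_norm0 eqxx.
by rewrite (Qp_norm_repr H) gt_eqF // ltr0q.
Qed.

Lemma Qp_normM x y : Qp_norm (x * y) = Qp_norm x * Qp_norm y.
Proof.
have [->|/Qp_neq0[c c0 H]] := eqVneq x 0; first by rewrite mul0r Qp_norm0 mul0r.
have [->|/Qp_neq0[d d0 K]] := eqVneq y 0; first by rewrite mulr0 Qp_norm0 mulr0.
rewrite (Qp_norm_repr H) (Qp_norm_repr K) -rmorphM.
rewrite -{1}(Qp_reprK x) -{1}(Qp_reprK y) -rmorphM; apply: Qp_norm_of.
have [N HN] := H; have [L KL] := K.
exists (maxn N L) => n; rewrite geq_max => /andP[Nn Ln].
by rewrite -(HN n) // -(KL n) // -rat_padic_normM.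
Qed.

Lemma Qp_normD x y : Qp_norm (x + y) <= Num.max (Qp_norm x) (Qp_norm y).
Proof.
have [->|x0] := eqVneq x 0; first by rewrite add0r le_max lexx orbT.
have [->|y0] := eqVneq y 0; first by rewrite addr0 le_max lexx.
have [->|xy0] := eqVneq (x + y) 0; first by rewrite Qp_norm0 le_max Qp_norm_ge0.
have [c _ [N HN]] := Qp_neq0 x0; have [d _ [L KL]] := Qp_neq0 y0.
have /asboolP sc := cauchy_valP (Qp_repr x + Qp_repr y).
have sn : ~ padic_null p (Qp_repr x + Qp_repr y).
  move=> sn; move: xy0; rewrite -{1}(Qp_reprK x) -{1}(Qp_reprK y) -rmorphD.
  by rewrite Qp_of_eq0; apply/negP; rewrite negbK; exact/asboolP.
have [b b0 [Q bQ]] := padic_cauchy_norm sc sn.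
rewrite (@Qp_norm_repr x c) ?(@Qp_norm_repr y d); [|by exists L|by exists N].
rewrite -{1}(Qp_reprK x) -{1}(Qp_reprK y) -rmorphD.
rewrite (@Qp_norm_of _ b); last by exists Q.
pose n := maxn Q (maxn N L).
rewrite -(bQ n) ?leq_maxl // -(HN n) ?leq_max ?leqnn ?orbT //.
rewrite -(KL n) ?leq_max ?leqnn ?orbT //.
by have := rat_padic_normD p (Qp_repr x n) (Qp_repr y n);
  rewrite !le_max !ler_rat.
Qed.

Lemma cst_cauchyb (q : rat) : (fun=> q) \in padic_cauchyb.
Proof.
by apply/asboolP => e e0; exists 0%N => m n _ _; rewrite subrr rat_padic_norm0.
Qed.

Definition Qp_rat (q : rat) : Qp := Qp_of (CauchySeq (cst_cauchyb q)).

Lemma Qp_norm_rat q : Qp_norm (Qp_rat q) = ratr (nrm q).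
Proof. by apply: Qp_norm_of; exists 0%N. Qed.

Lemma Qp_rat_dense x (e : R) : 0 < e -> exists q, Qp_norm (x - Qp_rat q) < e.
Proof.
move=> e0; have [d] := rat_in_itvoo e0; rewrite in_itv /= => /andP[].
rewrite ltr0q => d0 de.
have /asboolP uc := cauchy_valP (Qp_repr x); have [N uN] := uc d d0.
exists (Qp_repr x N).
have -> : x - Qp_rat (Qp_repr x N) =
    Qp_of (Qp_repr x - CauchySeq (cst_cauchyb (Qp_repr x N))).
  by rewrite [RHS](rmorphB Qp_of) [X in _ = X - _]Qp_reprK.
set w := Qp_repr x - _.
have wN n : (N <= n)%N -> nrm (w n) < d by move=> Nn; exact: uN.
have [->|] := eqVneq (Qp_of w) 0; first by rewrite Qp_norm0.
rewrite Qp_of_eq0 => /asboolP wn.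
have /asboolP wc := cauchy_valP w.
have [c _ [L wL]] := padic_cauchy_norm wc wn.
rewrite (@Qp_norm_of _ c); last by exists L.
apply: lt_trans de; rewrite ltr_rat -(wL (maxn N L)) ?leq_maxr //.
by rewrite wN ?leq_maxl.
Qed.

End QpNorm.

End CauchySequences.

Arguments Qp_norm {p} R x.

Definition Qp_open (p : nat) (R : realType) (A : set (Qp p)) : Prop :=
  forall x, A x ->
    exists2 e : R, 0 < e & forall y, Qp_norm R (y - x) < e -> A y.
Arguments Qp_open : clear implicits.

Notation Qp_borel p R := (g_sigma_algebraType (Qp_open p R)).

Section FractionalIntegral.
Variables (p : nat) (R : realType).
Local Notation Q := (Qp p).
Local Notation P := (p%:R : R).
Local Notation "`| x |_p" := (@Qp_norm p R x) (x at level 99).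
Local Open Scope classical_set_scope.

(* On the Borel sets these two conditions determine mu uniquely. *)
Definition normalized_haar (mu : {measure set (Qp_borel p R) -> \bar R}) : Prop :=
  (forall (a : Q) (A : set (Qp_borel p R)), measurable A ->
     mu [set a + x | x in (A : set Q)] = mu A) /\
  mu [set x : Q | `| x |_p <= 1] = 1%E.

Definition Qp_ball (N : int) : set Q := [set t | `| t |_p <= P ^ N].

Definition radial_on (D : set Q) (u : Q -> R) : Prop :=
  forall s t, D s -> D t -> `| s |_p = `| t |_p -> u s = u t.

Definition frac_const (alpha : R) : R :=
  if alpha == 1 then (1 - P) / (P * ln P)
  else (1 - P `^ (- alpha)) / (1 - P `^ (alpha - 1)).

Definition frac_kernel (alpha r : R) : R :=
  if alpha == 1 then ln r else r `^ (alpha - 1).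

(* [powR] and [ln] take junk values at 0; this affects the integrand only on
   the null set {0, x}. *)
Definition frac_integrand (alpha : R) (phi : Q -> R) (x y : Q) : R :=
  (frac_kernel alpha `| x - y |_p - frac_kernel alpha `| y |_p) * phi y.

Variable mu : {measure set (Qp_borel p R) -> \bar R}.

Definition frac_dom (x : Q) : set (Qp_borel p R) := [set y : Q | `| y |_p <= `| x |_p].

Definition frac_integrable (alpha : R) (phi : Q -> R) (x : Q) : Prop :=
  mu.-integrable (frac_dom x) (EFin \o frac_integrand alpha phi x).

Definition frac_integral (alpha : R) (phi : Q -> R) (x : Q) : R :=
  frac_const alpha * (\int[mu]_(y in frac_dom x) frac_integrand alpha phi x y)%R.

(* A radial solution on the ball of radius p^N; outside the ball the values of
   [u] are irrelevant, since I^alpha at t only sees the points y with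
   |y| <= |t|. Absolute convergence of I^alpha is part of being a solution. *)
Definition mild_solution (alpha gamma u0 : R) (f : R -> R -> R) (N : int)
    (u : Q -> R) : Prop :=
  let phi y := `| y |_p `^ (- gamma) * f `| y |_p (u y) in
  radial_on (Qp_ball N) u /\
  forall t, Qp_ball N t ->
    frac_integrable alpha phi t /\ u t = u0 + frac_integral alpha phi t.

End FractionalIntegral.

Arguments Qp_ball {p} R N.

(* Main.v *)
Require Import Defs.
From mathcomp Require Import all_boot all_order all_algebra.
From mathcomp Require Import ring lra.
From mathcomp Require Import all_classical all_reals all_analysis.
From mathcomp Require Import measurable_realfun.
Import Order.TTheory GRing.Theory Num.Theory.
Import numFieldNormedType.Exports.
Local Open Scope ring_scope.
Local Open Scope classical_set_scope.
Set Implicit Arguments.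
Unset Strict Implicit.
Unset Printing Implicit Defensive.

(** A mild solution is a fixed point of the map
[u |-> u0 + I^alpha (|.|^(-gamma) f(|.|, u))], and on a small enough ball around
0 this map is a contraction for the sup norm on radial functions.

Write [k] for the kernel of [I^alpha] (a power or the logarithm) and put
[h_x(y) = k(|y|) - k(|x|)]. For a radial [phi] the ultrametric inequality gives,
for [|y| <= |x|],
[[
  (k(|x - y|) - k(|y|)) phi(y) = h_x(y - x) phi(x) - h_x(y) phi(y),
]]
because [|x - y| = |x|] unless [|y| = |x|] ([frac_integrand_split]). The ball of
radius [|x|] is stable under translation by [x], so by translation invariance of
the Haar measure
[[
  (I^alpha phi)(x) = c * int_(|y| <= |x|) h_x(y) (phi(x) - phi(y)) dy
]]
([frac_integral_radial_form]). The right-hand side depends on [x] only through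
[|x|], so [I^alpha] preserves radial functions.

For the size, choose [delta > 0] with [1 - alpha <= delta] and
[theta = delta + gamma < 1], which is possible because [gamma < min(1, alpha)].
Then [|h_x(y)| <= C |y|^(-delta)] for [|y| <= |x| <= 1] ([frac_kernel_bound]). If
[|phi(y)| <= B |y|^(-gamma)], the integrand is dominated by
[2 C B |y|^(-theta)], whose integral over the ball of radius [p^N] is at most a
constant times [p^(N (1 - theta))]: sum over spheres, using that the ball of
radius [p^n] has measure at most [p^n] ([integral_abs_le_power_mass],
[haar_ball_le]). So [I^alpha] is bounded from such functions to bounded ones with
a norm that tends to 0 as [N] goes to minus infinity ([frac_integral_rate]).

Since [f] is Lipschitz in its second argument, the fixed-point map halves
distances once [N] is negative enough, and Picard iteration gives a solution on
the ball of radius [p^N]. Any two solutions restrict to solutions on a common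
smaller ball. There both are at a bounded distance from [u0] because [f] is
bounded, so their difference is bounded, and the contraction makes it vanish. *)

(** * The norm of the p-adic numbers *)

Section Norm.
Context (R : realType) (p : nat).
Implicit Types x y z : Qp p.
Local Notation nrm := (@Qp_norm p R).

Lemma Qp_normN x : nrm (- x) = nrm x.
Proof.
(* |-1| is a nonnegative square root of |1| = 1. *)
have n1 : nrm (-1) = 1.
  have /eqP : nrm (-1) ^+ 2 = 1.
    rewrite expr2 -Qp_normM mulrNN mulr1.
    have /eqP := Qp_normM R (1 : Qp p) 1.
    rewrite mulr1 -subr_eq0 -{1}(mulr1 (nrm 1)) -mulrBr mulf_eq0 subr_eq0.
    by rewrite Qp_norm_eq0 oner_eq0 /= => /eqP.
  rewrite sqrf_eq1 => /orP[/eqP //|/eqP h].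
  by have := Qp_norm_ge0 R (-1 : Qp p); rewrite h lerNr oppr0 ler10.
by rewrite -mulN1r Qp_normM n1 mul1r.
Qed.

Lemma Qp_distC x y : nrm (x - y) = nrm (y - x).
Proof. by rewrite -Qp_normN opprB. Qed.

Lemma Qp_normB x y : nrm (x - y) <= Num.max (nrm x) (nrm y).
Proof. by have := Qp_normD R x (- y); rewrite Qp_normN. Qed.

Lemma Qp_norm_gt0 x : (0 < nrm x) = (x != 0).
Proof. by rewrite lt0r Qp_norm_eq0 Qp_norm_ge0 andbT. Qed.

(** Every triangle in an ultrametric space is isosceles. *)
Lemma Qp_norm_iso x y : nrm y < nrm x -> nrm (x - y) = nrm x.
Proof.
move=> yx; apply/eqP; rewrite eq_le; apply/andP; split.
  by apply: le_trans (Qp_normB x y) _; rewrite ge_max lexx ltW.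
have := Qp_normD R (x - y) y; rewrite subrK le_max => /orP[//|].
by rewrite leNgt yx.
Qed.

(** This is what makes every set defined by a condition on the norm Borel. *)
Lemma Qp_norm_locally_constant x y : nrm (y - x) < nrm x -> nrm y = nrm x.
Proof.
by move=> h; rewrite -(@Qp_norm_iso x (x - y)) ?subKr // Qp_distC.
Qed.

Lemma Qp_ballS (m n : int) : (0 < p)%N -> m <= n ->
  Qp_ball R m `<=` (Qp_ball R n : set (Qp p)).
Proof.
by move=> p0 mn x /le_trans; apply; rewrite ler_weXz2l // ler1n.
Qed.

Lemma Qp_ball_sub N x y : Qp_ball R N x -> Qp_ball R N y ->
  Qp_ball R N (x - y).
Proof.
by move=> xN yN; apply: le_trans (Qp_normB x y) _; rewrite ge_max xN.
Qed.

Lemma Qp_norm_ratM (a b : rat) :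
  nrm (Qp_rat p (a * b)) = nrm (Qp_rat p a) * nrm (Qp_rat p b).
Proof. by rewrite !Qp_norm_rat rat_padic_normM rmorphM. Qed.

Hypothesis p_prime : prime p.

Lemma prime_base_gt1 : 1 < p%:R :> R.
Proof. by rewrite ltr1n prime_gt1. Qed.

Lemma prime_base_gt0 : 0 < p%:R :> R.
Proof. exact: lt_trans prime_base_gt1. Qed.

Lemma Qp_norm_values x : x != 0 -> exists n : int, nrm x = p%:R ^ n.
Proof.
move=> x0; have [c c0 [N xN]] := Qp_neq0 x0.
have h : nrm x = ratr c by apply: Qp_norm_repr; exists N.
move: c0; rewrite h -(xN N) // rat_padic_norm_gt0 /rat_padic_norm => /negbTE->.
by eexists; rewrite fmorphXz /= ratr_nat.
Qed.

Lemma Qp_rat_is_zmod_morphism : zmod_morphism (@Qp_rat p).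
Proof.
move=> a b; rewrite /Qp_rat -rmorphB; congr (Qp_of _).
exact/val_inj.
Qed.

Lemma Qp_norm_expp (n : int) : nrm (Qp_rat p (p%:R ^ n)) = p%:R ^ (- n).
Proof.
rewrite Qp_norm_rat.
have pr0 : (p%:R : rat) != 0 by rewrite pnatr_eq0 -lt0n prime_gt0.
have nV k : rat_padic_norm p ((p%:R : rat) ^+ k) = p%:R ^- k.
  elim: k => [|k IH]; first by rewrite !expr0 rat_padic_norm1 invr1.
  rewrite exprS rat_padic_normM IH.
  have -> : rat_padic_norm p p%:R = p%:R^-1.
    have := @rat_padic_norm_frac p p%:Z 1; rewrite divr1 => ->//.
      by rewrite logn1 sub0r [logn p _](pfactorK 1 p_prime).
    by rewrite eqz_nat -lt0n prime_gt0.
  by rewrite -invfM -exprS.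
case: n => k.
  by rewrite -exprnP nV -exprnN fmorphV rmorphXn /= ratr_nat.
rewrite NegzE -exprnN rat_padic_normV nV invrK opprK -exprnP.
by rewrite rmorphXn /= ratr_nat.
Qed.

Lemma Qp_norm_nat_lt (d : nat) : (0 < d < p)%N -> nrm (Qp_rat p d%:R) = 1.
Proof.
case/andP=> d0 dp; rewrite Qp_norm_rat.
have := @rat_padic_norm_frac p d%:Z 1; rewrite divr1 => ->//; last first.
  by rewrite eqz_nat -lt0n.
rewrite logn1 sub0r /= lognE p_prime d0 /=.
by rewrite gtnNdvd // oppr0 expr0z rmorph1.
Qed.

End Norm.

(** * Borel sets and Haar measure *)

Section Borel.
Context (R : realType) (p : nat).
Local Notation nrm := (@Qp_norm p R).

Lemma Qp_open_measurable (A : set (Qp_borel p R)) :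
  Qp_open p R A -> measurable A.
Proof. exact: sub_sigma_algebra. Qed.

(** Away from [x] the distance to [x] is locally constant, so for an arbitrary [A]
the set is open when [A] omits 0, and its complement is open otherwise. *)
Lemma measurable_dist_preimage (x : Qp p) (A : set R) :
  measurable ([set y | A (nrm (y - x))] : set (Qp_borel p R)).
Proof.
wlog A0 : A / ~ A 0.
  move=> H; have [A0|/H//] := pselect (A 0).
  rewrite -[X in measurable X]setCK; apply: measurableC.
  exact: (H (~` A)).
apply: Qp_open_measurable => y Ay; exists (nrm (y - x)).
  rewrite Qp_norm_gt0; apply/eqP => yx.
  by move: Ay; rewrite /= yx Qp_norm0.
move=> z zy; rewrite /= (@Qp_norm_locally_constant _ _ (y - x) (z - x)) //.
by rewrite opprB addrA subrK.
Qed.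

Lemma measurable_fun_dist (G : R -> R) (x : Qp p) (D : set (Qp_borel p R)) :
  measurable_fun D (fun y : Qp_borel p R => G (nrm (y - x))).
Proof.
move=> mD Y _; apply: measurableI => //.
exact: (measurable_dist_preimage x (G @^-1` Y)).
Qed.

Lemma measurable_fun_norm (G : R -> R) (D : set (Qp_borel p R)) :
  measurable_fun D (fun y : Qp_borel p R => G (nrm y)).
Proof.
have := @measurable_fun_dist G 0 D.
by under [X in measurable_fun _ X -> _]eq_fun do rewrite subr0.
Qed.

Lemma measurable_norm_le (c : R) :
  measurable ([set y | nrm y <= c] : set (Qp_borel p R)).
Proof.
have := @measurable_dist_preimage 0 [set r | r <= c].
by under eq_set do rewrite /= subr0.
Qed.

Lemma measurable_norm_eq (c : R) :
  measurable ([set y | nrm y = c] : set (Qp_borel p R)).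
Proof.
have := @measurable_dist_preimage 0 [set c].
by under eq_set do rewrite /= subr0.
Qed.

Lemma measurable_Qp_set1_0 : measurable ([set 0] : set (Qp_borel p R)).
Proof.
have := measurable_norm_eq 0; rewrite (_ : [set y | _] = [set 0]) //.
apply/seteqP; split => y /=; last by move->; exact: Qp_norm0.
by move/eqP; rewrite Qp_norm_eq0 => /eqP.
Qed.

(** A radial function on [D] is a function of the norm, and on [D] its preimages
are preimages under the norm. *)
Lemma measurable_radial (D : set (Qp_borel p R)) (phi : Qp p -> R) :
  radial_on D phi -> measurable_fun D (phi : Qp_borel p R -> R).
Proof.
move=> rphi mD Y _.
rewrite (_ : D `&` _ =
    D `&` [set y | (nrm @` (D `&` phi @^-1` Y)) (nrm (y - 0))]).
  apply: measurableI => //.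
  exact: (measurable_dist_preimage 0 (nrm @` (D `&` phi @^-1` Y))).
apply/seteqP; split => y /=; rewrite subr0.
  by move=> [Dy Yy]; split=> //; exists y.
by move=> [Dy [z [Dz Yz] zy]]; split=> //; rewrite /= -(rphi z).
Qed.

(** Translations are isometries, so they pull open sets back to open sets. *)
Lemma measurable_translation (x : Qp p) :
  measurable_fun setT ((fun y => y - x) : Qp_borel p R -> Qp_borel p R).
Proof.
apply: (@measurability _ _ (Qp_borel p R) (Qp_borel p R) setT _
  (Qp_open p R) erefl) => _ [A oA <-].
rewrite setTI; apply: Qp_open_measurable => y /oA[e e0 eA].
by exists e => // z zy; apply: eA; rewrite opprB addrA subrK.
Qed.

End Borel.

Section Haar.
Context (R : realType) (p : nat).
Local Notation nrm := (@Qp_norm p R).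
Context (mu : {measure set (Qp_borel p R) -> \bar R}).
Hypothesis mu_haar : normalized_haar mu.
Local Notation ball n := (Qp_ball R n : set (Qp_borel p R)).

Lemma haar_preimage_sub (x : Qp p) (A : set (Qp_borel p R)) : measurable A ->
  mu ((fun y : Qp p => y - x) @^-1` A) = mu A.
Proof.
move=> mA; rewrite -(mu_haar.1 x A mA); congr (mu _).
apply/seteqP; split => [y /= Ay|_ [y Ay <-]] /=.
  by exists (y - x) => //; rewrite addrC subrK.
by rewrite addrC addKr.
Qed.

Lemma haar_integral_translation (x : Qp p) (D : set (Qp_borel p R))
    (G : Qp p -> R) :
  measurable D -> measurable_fun setT (G : Qp_borel p R -> R) ->
  mu.-integrable D (EFin \o G) ->
  let tau : Qp_borel p R -> Qp_borel p R := fun y => (y : Qp p) - x in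
  mu.-integrable (tau @^-1` D) (EFin \o (G \o tau)) /\
  (\int[mu]_(y in tau @^-1` D) G (tau y) = \int[mu]_(y in D) G y)%R.
Proof.
move=> mD mG iG tau.
have mtau : measurable_fun setT (tau : Qp_borel p R -> Qp_borel p R).
  exact: measurable_translation.
have mGE : measurable_fun setT (fun y : Qp_borel p R => (G y)%:E).
  exact/measurable_EFinP.
have mtD : measurable (tau @^-1` D : set (Qp_borel p R)).
  by rewrite -[X in measurable X]setTI; exact: mtau.
have int_eq (K : Qp_borel p R -> \bar R) :
    (\int[pushforward mu tau]_(y in D) K y = \int[mu]_(y in D) K y)%E.
  apply: eq_measure_integral => A mA _.
  exact: haar_preimage_sub.
have i2 : mu.-integrable (tau @^-1` D) (EFin \o (G \o tau)).
  apply/integrableP; split.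
    apply/measurable_EFinP; apply: measurable_funTS.
    exact: measurableT_comp.
  have /integrableP[_] := iG; rewrite -int_eq ge0_integral_pushforward //.
  by apply: measurable_funTS; apply: measurableT_comp.
split=> //; rewrite /Rintegral; congr fine.
by rewrite -int_eq (integral_pushforward mtau mGE i2 mD).
Qed.

Hypothesis p_prime : prime p.

(** The balls of radius [p^(n-1)] centred at [d p^(-n)], [0 <= d < p], are
pairwise disjoint, because their centres are at distance [p^n] from each other,
and they all lie in the ball of radius [p^n]. Inserting
this into the normalization bounds the measure of small balls. *)
Lemma haar_ball_packing (n : int) :
  (p%:R%:E * mu (ball (n - 1)) <= mu (ball n))%E.
Proof.
have p0 : p%:R != 0 :> R by rewrite gt_eqF // prime_base_gt0.
pose c (i : 'I_p) : Qp p := Qp_rat p (i%:R * p%:R ^ (- n)).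
have cij (i j : 'I_p) : (j < i)%N -> nrm (c i - c j) = p%:R ^ n.
  move=> ji.
  have -> : c i - c j = Qp_rat p ((i - j)%:R * p%:R ^ (- n)).
    by rewrite /c -Qp_rat_is_zmod_morphism natrB ?(ltnW ji) // mulrBl.
  rewrite Qp_norm_ratM.
  rewrite Qp_norm_nat_lt ?mul1r ?Qp_norm_expp ?opprK //.
  by rewrite subn_gt0 ji (leq_ltn_trans (leq_subr _ _)).
have ci i : nrm (c i) <= p%:R ^ n.
  case: i => -[|i] ip.
    by rewrite /c /= mul0r Qp_norm_rat rat_padic_norm0 rmorph0 exprz_ge0.
  rewrite /c Qp_norm_ratM.
  by rewrite Qp_norm_nat_lt ?mul1r ?Qp_norm_expp ?opprK.
pose B i := (fun y : Qp p => y - c i) @^-1` (ball (n - 1)).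
have mB i : measurable (B i : set (Qp_borel p R)).
  exact: (@measurable_dist_preimage R p (c i) [set r | r <= p%:R ^ (n - 1)]).
have pn : p%:R ^ (n - 1) < p%:R ^ n :> R.
  by rewrite ltr_eXz2l ?prime_base_gt1 // ltrBlDr ltrDl.
have tB : trivIset setT B.
  move=> i j _ _ [y [/= yi yj]].
  wlog ij : i j yi yj / (j <= i)%N.
    by move=> H; have [/H->//|/ltnW /H->] := leqP j i.
  have [/val_inj//|nij] := eqVneq (val i) (val j).
  have := cij i j; rewrite ltn_neqAle eq_sym nij ij => /(_ isT) h.
  have : nrm (c i - c j) <= p%:R ^ (n - 1).
    have -> : c i - c j = (y - c j) - (y - c i).
      by rewrite opprB [RHS]addrC addrA subrK.
    exact: (@Qp_ball_sub R p (n - 1)).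
  by rewrite h leNgt pn.
have -> : (p%:R%:E * mu (ball (n - 1)) = \sum_(i < p) mu (B i))%E.
  rewrite (eq_bigr (fun=> mu (ball (n - 1)))) => [|i _].
    by rewrite sumr_const card_ord mule_natl.
  by apply: haar_preimage_sub; exact: measurable_norm_le.
rewrite -measure_bigsetU_ord //; apply: le_measure.
- by rewrite inE; apply: bigsetU_measurable.
- by rewrite inE; exact: measurable_norm_le.
- apply: (big_ind (fun A => A `<=` ball n)) => [//|A A' An A'n|i _ y /= yi].
    by rewrite subUset.
  rewrite /Qp_ball /= -(subrK (c i) y); apply: le_trans (Qp_normD R _ _) _.
  by rewrite ge_max ci (le_trans yi (ltW pn)).
Qed.

Lemma haar_ball_le (n : int) : n <= 0 -> (mu (ball n) <= (p%:R ^ n)%:E)%E.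
Proof.
move=> n0; have [k ->] : exists k : nat, n = - k%:Z.
  by case: n n0 => [[|k]|k] // _; [exists 0%N|exists k.+1].
elim: k => [|k IH]; first by rewrite oppr0 expr0z /Qp_ball expr0z mu_haar.2.
have p0 : 0 < p%:R :> R := prime_base_gt0 _ p_prime.
have := le_trans (haar_ball_packing (- k%:Z)) IH.
rewrite muleC -lee_pdivlMr // -EFinM.
have -> : - k%:Z - 1 = - k.+1%:Z by rewrite -addn1 PoszD opprD.
move=> /le_trans; apply; rewrite lee_fin -addn1 PoszD opprD expfzDr ?gt_eqF //.
Qed.

End Haar.

(** * Functions dominated by a power of the norm *)

Section RadialDomination.
Context (R : realType) (p : nat).
Local Notation nrm := (@Qp_norm p R).
Local Notation P := (p%:R : R).
Context (mu : {measure set (Qp_borel p R) -> \bar R}).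
Hypothesis mu_haar : normalized_haar mu.
Hypothesis p_prime : prime p.
Local Notation ball n := (Qp_ball R n : set (Qp_borel p R)).
Let P1 : 1 < P. Proof. exact: prime_base_gt1. Qed.
Let P0 : 0 < P. Proof. exact: prime_base_gt0. Qed.
Let Pn0 : P != 0. Proof. exact: lt0r_neq0. Qed.

Definition Qp_sphere (n : int) : set (Qp_borel p R) := [set y | nrm y = P ^ n].

Lemma measurable_Qp_ball n : measurable (ball n).
Proof. exact: measurable_norm_le. Qed.

Lemma measurable_Qp_sphere n : measurable (Qp_sphere n).
Proof. exact: measurable_norm_eq. Qed.

Lemma prime_base_powN_lt1 (eta : R) : 0 < eta -> 0 < P `^ (- eta) < 1.
Proof.
move=> eta0; rewrite powR_gt0 //=.
rewrite powRN invf_lt1 ?powR_gt0 //.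
have : 1 `^ eta < P `^ eta.
  by apply: gt0_ltr_powR; rewrite ?nnegrE ?ler01 ?(ltW P0).
by rewrite powR1.
Qed.

Lemma exists_expr_lt (z e : R) : 0 <= z < 1 -> 0 < e -> exists k, z ^+ k < e.
Proof.
move=> /andP[z0 z1] e0; have z1' : `|z| < 1 by rewrite ger0_norm.
have /cvgrPdist_lt /(_ e e0)[k _ /(_ k (leqnn k))] := cvg_geometric 1 z1'.
by rewrite /= sub0r normrN mul1r normrX ger0_norm // => ?; exists k.
Qed.

Lemma exprzB_nat (n : int) (k : nat) : P ^ (n - k%:Z) = P ^ n * P^-1 ^+ k.
Proof. by rewrite expfzDr // -exprz_inv. Qed.

(** Points are null sets because small balls have small measure. *)
Lemma haar_set1_0 : mu [set 0 : Qp p] = 0%E.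
Proof.
apply/eqP; rewrite -measure_le0; apply/lee_addgt0Pr => e e0; rewrite add0e.
have [|k ke] := @exists_expr_lt P^-1 e _ e0.
  by rewrite invr_ge0 ltW //= invf_lt1.
have k0 : - k%:Z <= 0 by rewrite oppr_le0.
apply: (@le_trans _ _ (mu (ball (- k%:Z)))).
  apply: le_measure; rewrite ?inE.
  - exact: measurable_Qp_set1_0.
  - exact: measurable_Qp_ball.
  - by move=> _ ->; rewrite /Qp_ball /= Qp_norm0 exprz_ge0 // ltW.
apply: le_trans (haar_ball_le mu_haar p_prime k0) _.
by rewrite lee_fin -[- _]add0r exprzB_nat expr0z mul1r ltW.
Qed.

Lemma Qp_ball_shells n :
  ball n = [set 0] `|` \bigcup_k Qp_sphere (n - k%:Z).
Proof.
apply/seteqP; split => y.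
  rewrite /Qp_ball /= => yn; have [->|y0] := eqVneq y 0; [by left|right].
  have [m ym] := Qp_norm_values R y0.
  move: yn; rewrite ym ler_eXz2l // -subr_ge0 => mn.
  by exists `|n - m|%N => //; rewrite /Qp_sphere /= gez0_abs // subKr.
case=> [->|[k _]]; rewrite /Qp_ball /Qp_sphere /=.
  by rewrite Qp_norm0 exprz_ge0 // ltW.
by move->; rewrite ler_eXz2l // gerBl.
Qed.

Lemma trivIset_shells n : trivIset setT (fun k : nat => Qp_sphere (n - k%:Z)).
Proof.
move=> i j _ _ [y []]; rewrite /Qp_sphere /= => -> /eqP.
have P_neq1 : P != 1 by rewrite gt_eqF.
by rewrite (inj_eq (ieexprIz P0 P_neq1)) => /eqP/addrI/oppr_inj[].
Qed.

Variables (theta : R).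
Hypothesis theta_lt1 : theta < 1.

(** An upper bound for the integral of [|y|^(-theta)] over the ball of radius
[r]: the shell of radius [r p^(-k)] contributes at most
[(r p^(-k))^(1 - theta)], and these terms form a geometric series. *)
Definition power_mass (r : R) : R :=
  r `^ (1 - theta) / (1 - P `^ (- (1 - theta))).

Lemma power_mass_ge0 r : 0 <= power_mass r.
Proof.
have /andP[_ z1] : 0 < P `^ (- (1 - theta)) < 1.
  by rewrite prime_base_powN_lt1 // subr_gt0.
by rewrite divr_ge0 ?subr_ge0 ?(ltW z1) // powR_ge0.
Qed.

Lemma power_mass_le r s : 0 <= r -> r <= s -> power_mass r <= power_mass s.
Proof.
move=> r0 rs; have /andP[_ z1] : 0 < P `^ (- (1 - theta)) < 1.
  by rewrite prime_base_powN_lt1 // subr_gt0.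
rewrite ler_pM2r ?invr_gt0 ?subr_gt0 //; apply: ge0_ler_powR => //.
- by rewrite subr_ge0 ltW.
- by rewrite nnegrE (le_trans r0).
Qed.

(** The origin has to be excluded from the bound, because [powR] gives
[|y|^(-theta)] the value 0 at [y = 0] when [theta != 0]; it is a null set. *)
Lemma integral_abs_le_power_mass (n : int) (C : R) (H : Qp p -> R) :
  n <= 0 -> 0 <= C -> measurable_fun (ball n) (H : Qp_borel p R -> R) ->
  (forall y, ball n y -> y != 0 -> `|H y| <= C * nrm y `^ (- theta)) ->
  (\int[mu]_(y in ball n) `|(H y)%:E| <= (C * power_mass (P ^ n))%:E)%E.
Proof.
move=> n0 C0 mH leH.
have z01 : 0 < P `^ (- (1 - theta)) < 1.
  by rewrite prime_base_powN_lt1 // subr_gt0.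
set z := P `^ _ in z01; have /andP[z0 z1] := z01.
have mS k := measurable_Qp_sphere (n - k%:Z).
have m0 := @measurable_Qp_set1_0 R p.
have mH' : measurable_fun (ball n) (fun y : Qp_borel p R => `|(H y)%:E|%E).
  by apply: measurableT_comp => //; apply/measurable_EFinP.
have := mH'; rewrite Qp_ball_shells => mHU.
rewrite ge0_integral_setU //; last 2 first.
  exact: bigcupT_measurable.
  rewrite disj_set2E; apply/eqP/seteqP; split => // y [/= -> [k _]].
  by rewrite /Qp_sphere /= Qp_norm0 => /eqP; rewrite lt_eqF // exprz_gt0.
rewrite (@null_set_integral _ _ _ mu) //; last 2 first.
- exact: measurable_fun_set1.
- exact: haar_set1_0.
rewrite add0e ge0_integral_bigcup //; last 2 first.
- apply: measurable_funS mHU => //; apply: measurableU => //.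
  exact: bigcupT_measurable.
- exact: trivIset_shells.
have term k : (\int[mu]_(y in Qp_sphere (n - k%:Z)) `|(H y)%:E| <=
    (geometric (C * (P ^ n) `^ (1 - theta)) z k)%:E)%E.
  set r := P ^ (n - k%:Z); have r0 : 0 < r by rewrite exprz_gt0.
  have sub : Qp_sphere (n - k%:Z) `<=` ball n.
    by rewrite Qp_ball_shells => y yk; right; exists k.
  apply: (@le_trans _ _ (\int[mu]_(y in Qp_sphere (n - k%:Z))
      (C * r `^ (- theta))%:E)%E).
    apply: ge0_le_integral => //.
      by apply: measurable_funS mH' => //; exact: measurable_Qp_ball.
    move=> y yk; rewrite lee_fin; have := leH y (sub y yk).
    rewrite yk; apply; rewrite -(Qp_norm_gt0 R) yk //.
  rewrite integral_cst //.
  apply: (@le_trans _ _ ((C * r `^ (- theta))%:E * r%:E)%E).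
    apply: lee_wpmul2l; first by rewrite lee_fin mulr_ge0 ?powR_ge0.
    have nk0 : n - k%:Z <= 0 by rewrite subr_le0 (le_trans n0).
    apply: le_trans (haar_ball_le mu_haar p_prime nk0).
    apply: le_measure; rewrite ?inE //; first exact: measurable_Qp_ball.
    by move=> y /= yk; rewrite /Qp_ball /= yk.
  rewrite -EFinM lee_fin /= -!mulrA ler_wpM2l //.
  rewrite -[X in _ * X](powRr1 (ltW r0)) -powRD ?(gt_eqF r0) ?implybT //.
  rewrite addrC /r exprzB_nat.
  rewrite powRM ?exprn_ge0 ?invr_ge0 ?exprz_ge0 ?(ltW P0) //.
  rewrite -(powR_inv1 (ltW P0)) -!powR_mulrn ?powR_ge0 // -!powRrM.
  by rewrite mulN1r [in leRHS]mulNr [k%:R * _]mulrC.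
apply: le_trans (lee_nneseries _ _) _.
- by move=> *; apply: integral_ge0.
- by move=> k _; exact: term.
apply: lime_le.
  apply: is_cvg_nneseries => k _ _; rewrite lee_fin; apply: geometric_ge0.
    by rewrite mulr_ge0 ?powR_ge0.
  exact: ltW.
apply: nearW => k; rewrite sumEFin lee_fin /power_mass mulrA.
apply: geometric_le_lim => //; first by rewrite mulr_ge0 ?powR_ge0.
by rewrite gtr0_norm.
Qed.

Lemma power_dominated_integrable (n : int) (C : R) (H : Qp p -> R) :
  n <= 0 -> 0 <= C -> measurable_fun (ball n) (H : Qp_borel p R -> R) ->
  (forall y, ball n y -> y != 0 -> `|H y| <= C * nrm y `^ (- theta)) ->
  mu.-integrable (ball n) (EFin \o H) /\
  `|\int[mu]_(y in ball n) H y|%R <= C * power_mass (P ^ n).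
Proof.
move=> n0 C0 mH leH; have le := integral_abs_le_power_mass n0 C0 mH leH.
have mHE : measurable_fun (ball n) (fun y : Qp_borel p R => (H y)%:E).
  exact/measurable_EFinP.
have iH : mu.-integrable (ball n) (EFin \o H).
  by apply/integrableP; split=> //; apply: le_lt_trans le _; exact: ltry.
split=> //; rewrite -lee_fin; apply: le_trans le; rewrite /Rintegral -abse_EFin.
rewrite fineK; last exact: (integrable_fin_num (measurable_Qp_ball n) iH).
exact: (le_abse_integral mu (measurable_Qp_ball n)).
Qed.

Lemma power_mass_small (e : R) : 0 < e ->
  exists2 N : int, N <= 0 & power_mass (P ^ N) < e.
Proof.
move=> e0; have eta0 : 0 < 1 - theta by rewrite subr_gt0.
have := prime_base_powN_lt1 eta0.
rewrite /power_mass; set z := _ `^ (- _) => /andP[z0 z1].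
have z10 : 0 < 1 - z by rewrite subr_gt0.
have [|k kz] := @exists_expr_lt z (e * (1 - z)) _ (mulr_gt0 e0 z10).
  by rewrite ltW.
exists (- k%:Z); first by rewrite oppr_le0.
rewrite ltr_pdivrMr //; move: kz.
rewrite -powR_mulrn ?ltW // /z -!powRrM -powR_intmul ?ltW // -powRrM.
by rewrite mulNr mulrC -mulNr mulrNz.
Qed.

End RadialDomination.

(** * The kernel of the fractional integral *)

Section Kernel.
Context (R : realType) (p : nat).
Local Notation nrm := (@Qp_norm p R).

Lemma powRN_antitone (g r s : R) : 0 <= g -> 0 < r -> r <= s ->
  s `^ (- g) <= r `^ (- g).
Proof.
move=> g0 r0 rs; have s0 := lt_le_trans r0 rs.
rewrite !powRN lef_pV2 ?posrE ?powR_gt0 //.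
by apply: ge0_ler_powR; rewrite ?nnegrE ?g0 ?(ltW r0) ?(ltW s0).
Qed.

(** One power [r^(-delta)] dominates the jump of the kernel between [r] and [s]
in all three regimes: both powers are at most [r^(-delta)] because [delta > 0]
and [delta >= 1 - alpha], and the logarithm is dominated by any negative power,
at the price of the constant [1 / delta]. *)
Lemma frac_kernel_bound (alpha delta r s : R) :
  0 < delta -> 1 - alpha <= delta -> 0 < r -> r <= s -> s <= 1 ->
  `|frac_kernel alpha r - frac_kernel alpha s| <=
    (1 + delta^-1) * r `^ (- delta).
Proof.
move=> d0 ad r0 rs s1; have s0 := lt_le_trans r0 rs.
have d1 : 0 < delta^-1 by rewrite invr_gt0.
have r1 := le_trans rs s1.
have rd0 : 0 < r `^ (- delta) by rewrite powR_gt0.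
rewrite mulrDl mul1r /frac_kernel; case: ifP => _.
  rewrite distrC ger0_norm ?subr_ge0 ?ler_ln ?posrE //.
  have lns : ln s <= 0 by rewrite ln_le0.
  have : ln (r `^ (- delta)) < r `^ (- delta) by apply: ln_sublinear.
  rewrite ln_powR => h.
  have : - ln r <= delta^-1 * r `^ (- delta).
    by rewrite mulrC ler_pdivlMr // mulrC mulrN -mulNr ltW.
  lra.
have ra : r `^ (alpha - 1) <= r `^ (- delta).
  by apply: ger_powR; [rewrite r0|lra].
have sa : s `^ (alpha - 1) <= r `^ (- delta).
  apply: le_trans (_ : s `^ (- delta) <= _).
    by apply: ger_powR; [rewrite s0|lra].
  exact: powRN_antitone (ltW d0) r0 rs.
have r00 := powR_ge0 r (alpha - 1); have s00 := powR_ge0 s (alpha - 1).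
have : 0 <= delta^-1 * r `^ (- delta) by rewrite mulr_ge0 // ltW.
by rewrite ler_norml; lra.
Qed.

(** In the ultrametric, [|x - y| = |x|] when [|y| < |x|], so the first kernel
difference only lives on the sphere [|y| = |x|], where [phi y = phi x], and the
second one vanishes on that sphere. Hence the integrand is the sum of a
translate of a radial function and a radial function. *)
Lemma frac_integrand_split (alpha : R) (phi : Qp p -> R) (x y : Qp p) :
  radial_on (frac_dom (R := R) x) phi -> frac_dom (R := R) x y ->
  frac_integrand alpha phi x y =
    (frac_kernel alpha (nrm (y - x)) - frac_kernel alpha (nrm x)) * phi x -
    (frac_kernel alpha (nrm y) - frac_kernel alpha (nrm x)) * phi y.
Proof.
move=> rphi xy; rewrite /frac_integrand Qp_distC.
move: (xy); rewrite /frac_dom /= le_eqVlt => /orP[/eqP yx|yx].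
  have -> : phi y = phi x by apply: rphi => //; exact: lexx.
  rewrite yx.
  move: (frac_kernel alpha (nrm (y - x))) (frac_kernel alpha (nrm x)) => a b.
  by ring.
have -> : nrm (y - x) = nrm x by rewrite Qp_distC Qp_norm_iso.
move: (frac_kernel alpha (nrm x)) (frac_kernel alpha (nrm y)) => a b.
by ring.
Qed.

End Kernel.

(** * Fractional integrals of radial functions *)

Section FracIntegralBound.
Context (R : realType) (p : nat) (mu : {measure set (Qp_borel p R) -> \bar R}).
Hypothesis mu_haar : normalized_haar mu.
Hypothesis p_prime : prime p.
Local Notation nrm := (@Qp_norm p R).
Local Notation dom x := (frac_dom (p := p) (R := R) x).
Variables (alpha gamma delta : R).
Hypotheses (gamma_gt0 : 0 < gamma) (delta_gt0 : 0 < delta).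
Hypotheses (alpha_delta : 1 - alpha <= delta) (theta_lt1 : delta + gamma < 1).
Local Notation jump := (fun x y : Qp p =>
  frac_kernel alpha (nrm y) - frac_kernel alpha (nrm x)).
Local Notation mass := (power_mass p (delta + gamma)).
(* The constant of [frac_kernel_bound]. *)
Let ck := 1 + delta^-1.

Let ck_ge0 : 0 <= ck.
Proof. by rewrite addr_ge0 // invr_ge0 ltW. Qed.

(** The kernel jump is at most [|y|^(-delta)] and [psi] at most [|y|^(-gamma)],
up to constants, so their product is dominated by [|y|^(-theta)] with
[theta = delta + gamma < 1], which is integrable near the origin. *)
Lemma kernel_jump_integrable (x : Qp p) (B : R) (psi : Qp p -> R) :
  x != 0 -> nrm x <= 1 -> 0 <= B ->
  measurable_fun (dom x) (psi : Qp_borel p R -> R) ->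
  (forall y, dom x y -> y != 0 -> `|psi y| <= B * nrm y `^ (- gamma)) ->
  mu.-integrable (dom x) (EFin \o (fun y => jump x y * psi y)) /\
  `|\int[mu]_(y in dom x) (jump x y * psi y)|%R <= ck * B * mass (nrm x).
Proof.
move=> x0 x1 B0 mpsi lepsi; have [n xn] := Qp_norm_values R x0.
have domE : dom x = Qp_ball R n by rewrite /frac_dom xn.
have n0 : n <= 0.
  rewrite leNgt; apply/negP => n0; move: x1; rewrite xn leNgt => /negP[].
  by rewrite -(expr0z p%:R) ltr_eXz2l // prime_base_gt1.
rewrite domE in mpsi lepsi *; rewrite xn.
apply: power_dominated_integrable => //; first exact: mulr_ge0.
  apply: measurable_funM => //.
  exact: (measurable_fun_norm
    (fun r => frac_kernel alpha r - frac_kernel alpha (p%:R ^ n))).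
move=> y yn y0; have y0' : 0 < nrm y by rewrite Qp_norm_gt0.
rewrite normrM opprD powRD; last by rewrite (gt_eqF y0') implybT.
rewrite [leRHS]mulrACA; apply: ler_pM => //; last exact: lepsi.
apply: frac_kernel_bound => //; last by rewrite -xn.
Qed.

(** Undoing the translation in [frac_integrand_split] by invariance of the Haar
measure leaves an expression in which [x] occurs only through [|x|] and
[phi x]. This gives at once that [I^alpha phi] is radial and how large it is. *)
Lemma frac_integral_radial_form (x : Qp p) (B : R) (phi : Qp p -> R) :
  x != 0 -> nrm x <= 1 -> 0 <= B -> radial_on (dom x) phi ->
  (forall y, dom x y -> y != 0 -> `|phi y| <= B * nrm y `^ (- gamma)) ->
  [/\ frac_integrable mu alpha phi x,
      frac_integral mu alpha phi x = frac_const p alpha *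
        (\int[mu]_(y in dom x) (jump x y * phi x)
          - \int[mu]_(y in dom x) (jump x y * phi y))%R &
      `|frac_integral mu alpha phi x| <=
        `|frac_const p alpha| * (2 * (ck * B * mass (nrm x)))].
Proof.
move=> x0 x1 B0 rphi lephi.
have mdom : measurable (dom x) by exact: measurable_norm_le.
have [i1 b1] : mu.-integrable (dom x) (EFin \o (fun y => jump x y * phi x)) /\
    `|\int[mu]_(y in dom x) (jump x y * phi x)|%R <= ck * B * mass (nrm x).
  apply: (@kernel_jump_integrable x B (fun=> phi x)) => // y xy y0.
  have := lephi x; rewrite /frac_dom /= lexx => /(_ isT x0) /le_trans; apply.
  have y0' : 0 < nrm y by rewrite Qp_norm_gt0.
  exact: (ler_wpM2l B0 (powRN_antitone (ltW gamma_gt0) y0' xy)).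
have [i2 b2] : mu.-integrable (dom x) (EFin \o (fun y => jump x y * phi y)) /\
    `|\int[mu]_(y in dom x) (jump x y * phi y)|%R <= ck * B * mass (nrm x).
  by apply: (@kernel_jump_integrable x B phi) => //; exact: measurable_radial.
have mG : measurable_fun setT ((fun y => jump x y * phi x) : Qp_borel p R -> R).
  exact: (measurable_fun_norm
    (fun r => (frac_kernel alpha r - frac_kernel alpha (nrm x)) * phi x)).
(* The ball of radius [|x|] is an additive group containing [x]. *)
have domK : (fun y : Qp_borel p R => (y : Qp p) - x) @^-1` dom x = dom x.
  apply/seteqP; split => y; rewrite /frac_dom /= => yx.
    rewrite -(subrK x y); apply: le_trans (Qp_normD _ _ _) _.
    by rewrite ge_max yx lexx.
  by apply: le_trans (Qp_normB _ _ _) _; rewrite ge_max yx lexx.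
have [] := haar_integral_translation mu_haar x mdom mG i1.
rewrite domK => i1' e1.
have integrand_split (y : Qp p) : dom x y -> frac_integrand alpha phi x y =
    jump x (y - x) * phi x - jump x y * phi y.
  by move=> xy; exact: frac_integrand_split.
have int : frac_integrable mu alpha phi x.
  have iB := integrableB mdom i1' i2.
  apply: (eq_integrable mdom) iB => y /set_mem xy.
  by rewrite /= (integrand_split _ xy).
have E : frac_integral mu alpha phi x = frac_const p alpha *
        (\int[mu]_(y in dom x) (jump x y * phi x)
          - \int[mu]_(y in dom x) (jump x y * phi y))%R.
  rewrite /frac_integral -e1 -(RintegralB mdom i1' i2); congr (_ * _).
  by apply: eq_Rintegral => y /set_mem xy; rewrite (integrand_split _ xy).
split; [exact: int|exact: E|rewrite E normrM].
apply: ler_wpM2l; first exact: normr_ge0.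
apply: le_trans (ler_normB _ _) _.
rewrite [leRHS]mulr_natl mulr2n; exact: lerD b1 b2.
Qed.

(** At the origin the domain is the single point 0, where the integrand itself
vanishes. *)
Lemma frac_integral0 (phi : Qp p -> R) :
  frac_integrable mu alpha phi 0 /\ frac_integral mu alpha phi 0 = 0.
Proof.
have dom0 (y : Qp p) : dom 0 y -> frac_integrand alpha phi 0 y = 0.
  rewrite /frac_dom /= Qp_norm0 => yle.
  have /eqP -> : y == 0 by rewrite -(Qp_norm_eq0 R) eq_le yle Qp_norm_ge0.
  by rewrite /frac_integrand [X in nrm X]subrr subrr mul0r.
have mdom : measurable (dom 0) by exact: measurable_norm_le.
split.
  have i0 : mu.-integrable (dom 0) (cst 0%E) by exact: integrable0.
  apply: (eq_integrable mdom) i0 => y /set_mem y0.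
  by rewrite /= (dom0 _ y0).
rewrite /frac_integral (_ : (\int[mu]_(y in dom 0) _)%R = 0) ?mulr0 //.
rewrite (@eq_Rintegral _ _ _ mu (dom 0) (fun=> 0)) ?Rintegral_cst ?mul0r //.
by move=> y /set_mem y0; rewrite (dom0 _ y0).
Qed.

Lemma frac_integralB (phi psi : Qp p -> R) (x : Qp p) :
  frac_integrable mu alpha phi x -> frac_integrable mu alpha psi x ->
  frac_integral mu alpha phi x - frac_integral mu alpha psi x =
  frac_integral mu alpha (fun y => phi y - psi y) x.
Proof.
move=> i1 i2; have mdom : measurable (dom x) by exact: measurable_norm_le.
rewrite /frac_integral -mulrBr -(RintegralB mdom i1 i2); congr (_ * _).
by apply: eq_Rintegral => y _; rewrite /frac_integrand mulrBr.
Qed.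

End FracIntegralBound.

(** * Contractions on a set of real functions *)

Section Contraction.
(* Only the values on [D] are compared, while [S] is a set of functions on all
   of [X]; in the application [D] is a ball, [S] the functions radial on it. *)
Context (R : realType) (X : Type) (D : set X).
Variables (T : (X -> R) -> (X -> R)) (S : set (X -> R)).
Hypothesis S_closed : forall (v : nat -> X -> R) (w : X -> R),
  (forall k, S (v k)) -> (forall x, D x -> v ^~ x @ \oo --> w x) -> S w.
Hypothesis T_stable : forall v, S v -> S (T v).
Hypothesis T_contract : forall (b : R) v w, S v -> S w ->
  (forall x, D x -> `|v x - w x| <= b) ->
  forall x, D x -> `|T v x - T w x| <= b / 2.

Lemma le0_of_le_halving (c a : R) : (forall k, a <= c / 2 ^+ k) -> a <= 0.
Proof.
move=> h; rewrite leNgt; apply/negP => a0.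
have c0 : 0 < c by have := h 0%N; rewrite expr0 divr1; exact: lt_le_trans.
have [|k] := @exists_expr_lt R 2^-1 (a / c) _ (divr_gt0 a0 c0).
  by apply/andP; split; lra.
by rewrite ltr_pdivlMr // exprVn mulrC ltNge h.
Qed.

(** The distance between two fixed points, once bounded, is halved over and
over by [T]. *)
Lemma contraction_fixed_unique (b : R) v w : S v -> S w ->
  (forall x, D x -> T v x = v x) -> (forall x, D x -> T w x = w x) ->
  (forall x, D x -> `|v x - w x| <= b) -> forall x, D x -> v x = w x.
Proof.
move=> Sv Sw Tv Tw vw x Dx; apply/eqP; rewrite -subr_eq0 -normr_le0.
apply: (@le0_of_le_halving b) => k.
elim: k x Dx => [|k IH] x Dx; first by rewrite expr0 divr1 vw.
rewrite -Tv // -Tw //; apply: le_trans (T_contract Sv Sw IH Dx) _.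
by rewrite exprSr invfM mulrA.
Qed.

(** Picard iteration: consecutive iterates differ by at most [B / 2^k] on [D],
so they converge there uniformly, and [T] passes to the limit. *)
Lemma contraction_fixed_exists (B : R) v0 : S v0 ->
  (forall x, D x -> `|T v0 x - v0 x| <= B) ->
  exists2 v, S v & forall x, D x -> T v x = v x.
Proof.
move=> Sv0 hB; pose v k := iter k T v0.
have Sv k : S (v k) by elim: k => //= k; exact: T_stable.
have step k x : D x -> `|v k.+1 x - v k x| <= B / 2 ^+ k.
  elim: k x => [|k IH] x Dx; first by rewrite expr0 divr1 hB.
  apply: le_trans (T_contract (Sv k.+1) (Sv k) IH Dx) _.
  by rewrite exprSr invfM mulrA.
have pow0 k : 0 < (2 ^+ k)^-1 :> R by rewrite invr_gt0 exprn_gt0.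
have tail k m x : D x ->
    `|v k x - v (k + m)%N x| <= 2 * B / 2 ^+ k - 2 * B / 2 ^+ (k + m).
  move=> Dx; elim: m => [|m IH]; first by rewrite addn0 !subrr normr0.
  rewrite addnS -(subrK (v (k + m)%N x) (v k x)) -addrA.
  apply: le_trans (ler_normD _ _) _; rewrite distrC [in X in _ + X]distrC.
  have := step (k + m)%N x Dx; rewrite distrC in IH.
  rewrite exprSr invfM mulrA => h; apply: le_trans (lerD IH h) _.
  set a := (2 ^+ (k + m))^-1; lra.
have B0 x : D x -> 0 <= B by move=> Dx; apply: le_trans (hB x Dx).
have dist k n x : D x -> (k <= n)%N -> `|v k x - v n x| <= 2 * B / 2 ^+ k.
  move=> Dx kn; rewrite -(subnKC kn); apply: le_trans (tail k (n - k)%N x Dx) _.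
  by rewrite gerBl mulr_ge0 ?(ltW (pow0 _)) // mulr_ge0 // (B0 x).
have small x (e : R) : D x -> 0 < e -> exists k, 2 * B / 2 ^+ k < e.
  move=> Dx e0; apply: contrapT => /forallNP h.
  have : e <= 0.
    by apply: (@le0_of_le_halving (2 * B)) => k; rewrite leNgt; apply/negP.
  by rewrite leNgt e0.
have vcvg x : D x -> cvgn (v ^~ x).
  move=> Dx; apply/cauchy_cvgP; apply: cauchy_exP => e e0.
  have [k ke] := small x e Dx e0; exists (v k x), k => // n /= kn.
  by rewrite /ball /=; apply: le_lt_trans ke; exact: dist.
pose w x := limn (v ^~ x).
have vw x : D x -> v ^~ x @ \oo --> w x by move=> /vcvg.
have Sw : S w by exact: S_closed Sv vw.
have dw k x : D x -> `|v k x - w x| <= 2 * B / 2 ^+ k.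
  move=> Dx; have h : (fun n => `|v k x - v n x|) @ \oo --> `|v k x - w x|.
    by apply: cvg_norm; apply: cvgB; [exact: cvg_cst|exact: vw].
  rewrite -(cvg_lim _ h) //; apply: limr_le.
    by apply/cvg_ex; eexists; exact: h.
  by exists k => // n /= kn; exact: dist.
exists w => // x Dx; apply/eqP; rewrite -subr_eq0 -normr_le0.
apply: (@le0_of_le_halving (2 * B)) => k.
have h1 : `|w x - v k.+1 x| <= 2 * B / 2 ^+ k.+1 by rewrite distrC dw.
have h2 : `|v k.+1 x - T w x| <= 2 * B / 2 ^+ k / 2.
  by apply: (T_contract (Sv k) Sw _ Dx) => y; exact: dw.
rewrite distrC -(subrK (v k.+1 x) (w x)) -addrA.
apply: le_trans (ler_normD _ _) _; apply: le_trans (lerD h1 h2) _.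
rewrite exprSr invfM; set a := (2 ^+ k)^-1; lra.
Qed.

End Contraction.

(** * Mild solutions *)

Section MildSolutions.
Context (R : realType) (p : nat) (mu : {measure set (Qp_borel p R) -> \bar R}).
Hypothesis p_prime : prime p.
Hypothesis mu_haar : normalized_haar mu.
Local Notation nrm := (@Qp_norm p R).
Local Notation dom x := (frac_dom (p := p) (R := R) x).
Local Notation ball N := (Qp_ball R N : set (Qp p)).
Variables (alpha gamma u0 : R) (f : R -> R -> R) (M F : R).
Hypothesis gamma_gt0 : 0 < gamma.
Hypothesis f_bounded : forall t : Qp p, t != 0 ->
  forall x : R, `|f (nrm t) x| <= M.
Hypothesis f_lipschitz : forall t : Qp p, t != 0 -> forall x y : R,
  `|f (nrm t) x - f (nrm t) y| <= F * `|x - y|.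
Hypothesis gamma_lt : gamma < Num.min 1 alpha.

(* The exponent for [frac_kernel_bound]. It exceeds 1 - min(1, alpha), hence
   both 0 and 1 - alpha, and stays below 1 - gamma, so that
   [delta + gamma < 1]. *)
Let delta := 1 - (gamma + Num.min 1 alpha) / 2.

Definition mild_source (u : Qp p -> R) (y : Qp p) : R :=
  nrm y `^ (- gamma) * f (nrm y) (u y).

Definition mild_map (u : Qp p -> R) (t : Qp p) : R :=
  u0 + frac_integral mu alpha (mild_source u) t.

Definition mild_factor : R := `|frac_const p alpha| * (2 * (1 + delta^-1)).

(** A bound for the norm of [I^alpha] on the ball of radius [p^N], from functions
bounded by a multiple of [|y|^(-gamma)] to bounded functions. It tends to 0 as
[N] goes to minus infinity. *)
Definition mild_rate (N : int) : R :=
  mild_factor * power_mass p (delta + gamma) (p%:R ^ N).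

Let gamma_lt1 : gamma < 1.
Proof. by apply: lt_le_trans gamma_lt _; rewrite ge_min lexx. Qed.

Let gamma_lt_alpha : gamma < alpha.
Proof. by apply: lt_le_trans gamma_lt _; rewrite ge_min lexx orbT. Qed.

Let min_le1 : Num.min 1 alpha <= 1.
Proof. by rewrite ge_min lexx. Qed.

Let min_le : Num.min 1 alpha <= alpha.
Proof. by rewrite ge_min lexx orbT. Qed.

Let delta_gt0 : 0 < delta.
Proof. by have := gamma_lt1; have := min_le1; rewrite /delta; lra. Qed.

Let alpha_delta : 1 - alpha <= delta.
Proof. by have := min_le; have := gamma_lt_alpha; rewrite /delta; lra. Qed.

Let theta_lt1 : delta + gamma < 1.
Proof. by have := gamma_lt; rewrite /delta; lra. Qed.

Let mild_factor_ge0 : 0 <= mild_factor.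
Proof.
by rewrite mulr_ge0 // mulr_ge0 // addr_ge0 // invr_ge0 ltW.
Qed.

Let one_neq0 : (1 : Qp p) != 0.
Proof. exact: oner_neq0. Qed.

Let M_ge0 : 0 <= M.
Proof. exact: le_trans (normr_ge0 _) (f_bounded one_neq0 0). Qed.

Let F_ge0 : 0 <= F.
Proof.
have := le_trans (normr_ge0 _) (f_lipschitz one_neq0 1 0).
by rewrite subr0 normr1 mulr1.
Qed.

Lemma mild_solutionE (N : int) (u : Qp p -> R) :
  mild_solution mu alpha gamma u0 f N u <->
  radial_on (ball N) u /\ forall t, ball N t ->
    frac_integrable mu alpha (mild_source u) t /\ u t = mild_map u t.
Proof. by []. Qed.

Lemma frac_dom_sub_ball (N : int) (t : Qp p) : ball N t -> dom t `<=` ball N.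
Proof. by move=> tN y /le_trans; apply. Qed.

Lemma norm_le1_of_ball (N : int) (t : Qp p) : N <= 0 -> ball N t -> nrm t <= 1.
Proof.
move=> N0 tN; have := @Qp_ballS R p _ _ (prime_gt0 p_prime) N0 t tN.
by rewrite /Qp_ball /= expr0z.
Qed.

Lemma mild_source_radial (D : set (Qp p)) u :
  radial_on D u -> radial_on D (mild_source u).
Proof. by move=> ru s t Ds Dt st; rewrite /mild_source (ru s t) // st. Qed.

Lemma mild_source_bound u (y : Qp p) : y != 0 ->
  `|mild_source u y| <= M * nrm y `^ (- gamma).
Proof.
move=> y0; rewrite /mild_source normrM mulrC.
rewrite [X in _ * X]ger0_norm ?powR_ge0 //.
by apply: ler_wpM2r; [exact: powR_ge0|exact: f_bounded].
Qed.

Lemma mild_source_lipschitz u v (b : R) (y : Qp p) : y != 0 ->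
  `|u y - v y| <= b ->
  `|mild_source u y - mild_source v y| <= F * b * nrm y `^ (- gamma).
Proof.
move=> y0 uv; rewrite /mild_source -mulrBr normrM mulrC.
rewrite [X in _ * X]ger0_norm ?powR_ge0 //.
apply: ler_wpM2r; first exact: powR_ge0.
by apply: le_trans (f_lipschitz y0 _ _) _; exact: ler_wpM2l.
Qed.

Lemma frac_integral_rate (N : int) (B : R) (phi : Qp p -> R) (t : Qp p) :
  N <= 0 -> 0 <= B -> ball N t -> radial_on (ball N) phi ->
  (forall y, ball N y -> y != 0 -> `|phi y| <= B * nrm y `^ (- gamma)) ->
  frac_integrable mu alpha phi t /\
  `|frac_integral mu alpha phi t| <= mild_rate N * B.
Proof.
move=> N0 B0 tN rphi lephi; have sub := frac_dom_sub_ball tN.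
have mass_ge0 r : 0 <= power_mass p (delta + gamma) r by exact: power_mass_ge0.
have [->|t0] := eqVneq t 0.
  have [i0 ->] := frac_integral0 mu alpha phi; split=> //.
  by rewrite normr0 mulr_ge0 // mulr_ge0.
have rphi' : radial_on (dom t) phi.
  by move=> s s' /sub sN /sub s'N; exact: rphi.
have [i _ le] := frac_integral_radial_form mu_haar p_prime gamma_gt0
  delta_gt0 alpha_delta theta_lt1 t0 (norm_le1_of_ball N0 tN) B0 rphi'
  (fun y yt => lephi y (sub y yt)).
split=> //; apply: le_trans le _.
have mono : power_mass p (delta + gamma) (nrm t) <=
    power_mass p (delta + gamma) (p%:R ^ N).
  by apply: power_mass_le => //; exact: Qp_norm_ge0.
rewrite /mild_rate /mild_factor; move: mono.
move: (power_mass _ _ (nrm t)) (power_mass _ _ (p%:R ^ N)) => a b ab.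
rewrite -!mulrA ler_wpM2l // ler_wpM2l //.
rewrite ler_wpM2l ?addr_ge0 ?invr_ge0 ?(ltW delta_gt0) //.
by rewrite mulrC ler_wpM2r.
Qed.

Lemma mild_map_radial (N : int) u : N <= 0 ->
  radial_on (ball N) u -> radial_on (ball N) (mild_map u).
Proof.
move=> N0 ru s t sN tN st; apply: (congr1 (+%R u0)).
have [s0|s0] := eqVneq s 0.
  have /eqP t0 : t == 0 by rewrite -(Qp_norm_eq0 R) -st s0 Qp_norm0.
  by rewrite s0 t0.
have t0 : t != 0 by rewrite -(Qp_norm_eq0 R) -st Qp_norm_eq0.
have rsrc := mild_source_radial ru.
have form (x : Qp p) : ball N x -> x != 0 ->
    frac_integral mu alpha (mild_source u) x = frac_const p alpha *
      (\int[mu]_(y in dom x) ((frac_kernel alpha (nrm y) -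
          frac_kernel alpha (nrm x)) * mild_source u x)
       - \int[mu]_(y in dom x) ((frac_kernel alpha (nrm y) -
          frac_kernel alpha (nrm x)) * mild_source u y))%R.
  move=> xN x0; have sub := frac_dom_sub_ball xN.
  have r' : radial_on (dom x) (mild_source u).
    by move=> y y' /sub yN /sub y'N; exact: rsrc.
  have [_ E _] := frac_integral_radial_form mu_haar p_prime gamma_gt0
    delta_gt0 alpha_delta theta_lt1 x0 (norm_le1_of_ball N0 xN) M_ge0 r'
    (fun y _ => @mild_source_bound u y).
  exact: E.
rewrite (form s sN s0) (form t tN t0) (rsrc s t sN tN st) /frac_dom.
by rewrite st.
Qed.

(** Since [f] is bounded, [mild_map u] stays close to [u0] whatever the size of
[u]; in particular every mild solution is bounded. *)
Lemma mild_map_dist (N : int) u (t : Qp p) : N <= 0 ->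
  radial_on (ball N) u -> ball N t ->
  frac_integrable mu alpha (mild_source u) t /\
  `|mild_map u t - u0| <= mild_rate N * M.
Proof.
move=> N0 ru tN; rewrite /mild_map addrC addKr.
apply: frac_integral_rate => // [|y _]; first exact: mild_source_radial.
exact: mild_source_bound.
Qed.

(** The Lipschitz bound on [f] turns a bound [b] on [u - v] into the bound
[F b |y|^(-gamma)] on the difference of the sources. *)
Lemma mild_map_contracts (N : int) (b : R) u v : N <= 0 ->
  mild_rate N * F <= 2^-1 ->
  radial_on (ball N) u -> radial_on (ball N) v ->
  (forall y, ball N y -> `|u y - v y| <= b) ->
  forall t, ball N t -> `|mild_map u t - mild_map v t| <= b / 2.
Proof.
move=> N0 rate ru rv uv t tN.
have b0 : 0 <= b by exact: le_trans (normr_ge0 _) (uv t tN).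
rewrite /mild_map opprD addrACA subrr add0r frac_integralB; last 2 first.
- by have [] := mild_map_dist N0 ru tN.
- by have [] := mild_map_dist N0 rv tN.
have [|y s yN sN ys|y yN y0|_ le] := @frac_integral_rate N (F * b)
  (fun y => mild_source u y - mild_source v y) t N0 _ tN.
- exact: mulr_ge0.
- by rewrite (mild_source_radial ru yN sN ys) (mild_source_radial rv yN sN ys).
- by apply: mild_source_lipschitz => //; exact: uv.
apply: le_trans le _; rewrite mulrA mulrC.
exact: ler_wpM2l.
Qed.

Lemma mild_solution_exists (N : int) : N <= 0 -> mild_rate N * F <= 2^-1 ->
  exists u, mild_solution mu alpha gamma u0 f N u.
Proof.
move=> N0 rate.
have [| | | | |u ru Tu] := @contraction_fixed_exists R (Qp p) (ball N)
  mild_map (radial_on (ball N)) _ _ _ (mild_rate N * M) (fun=> u0).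
- move=> v w rv vw s t sN tN st.
  have := vw s sN; rewrite (_ : v ^~ s = v ^~ t).
    by move=> vs; exact: (cvg_unique _ vs (vw t tN)).
  by apply/funext => k; exact: rv.
- by move=> v; exact: mild_map_radial.
- by move=> b v w; exact: mild_map_contracts.
- by [].
- by move=> t tN; have [] := @mild_map_dist N (fun=> u0) t N0 _ tN.
exists u; apply/mild_solutionE; split=> // t tN.
by rewrite Tu //; have [] := mild_map_dist N0 ru tN.
Qed.

Lemma mild_solution_unique (N : int) u v : N <= 0 -> mild_rate N * F <= 2^-1 ->
  mild_solution mu alpha gamma u0 f N u ->
  mild_solution mu alpha gamma u0 f N v ->
  forall t, ball N t -> v t = u t.
Proof.
move=> N0 rate /mild_solutionE[ru Tu] /mild_solutionE[rv Tv].
have near w t : radial_on (ball N) w -> ball N t -> w t = mild_map w t ->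
    `|w t - u0| <= mild_rate N * M.
  by move=> rw tN ->; have [] := mild_map_dist N0 rw tN.
apply: (@contraction_fixed_unique R (Qp p) (ball N) mild_map
  (radial_on (ball N)) _ (mild_rate N * M + mild_rate N * M)) => //.
- by move=> b w z; exact: mild_map_contracts.
- by move=> t tN; rewrite -(Tv t tN).2.
- by move=> t tN; rewrite -(Tu t tN).2.
move=> t tN; rewrite -(subrK u0 (v t)) -addrA.
apply: le_trans (ler_normD _ _) _; rewrite [in X in _ + X]distrC.
apply: lerD; first exact: near (Tv t tN).2.
exact: near (Tu t tN).2.
Qed.

Lemma mild_solution_shrink (K N : int) u : K <= N ->
  mild_solution mu alpha gamma u0 f N u ->
  mild_solution mu alpha gamma u0 f K u.
Proof.
move=> KN /mild_solutionE[ru Tu]; have sub := Qp_ballS (prime_gt0 p_prime) KN.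
apply/mild_solutionE; split=> [s t /sub sN /sub tN|t /sub tN].
  exact: ru.
exact: Tu.
Qed.

Lemma mild_rate_small : exists2 N0 : int, N0 <= 0 &
  forall N, N <= N0 -> mild_rate N * F <= 2^-1.
Proof.
have c0 : 0 <= mild_factor * F by exact: mulr_ge0.
have e0 : 0 < (2 * (mild_factor * F + 1))^-1.
  by rewrite invr_gt0 mulr_gt0 // ltr_wpDl.
have [N0 N00 small] := power_mass_small p_prime theta_lt1 e0.
exists N0 => // N NN0; rewrite /mild_rate mulrAC.
have le : power_mass p (delta + gamma) (p%:R ^ N) <=
    (2 * (mild_factor * F + 1))^-1.
  apply: le_trans (ltW small); apply: power_mass_le => //.
    by rewrite exprz_ge0.
  by rewrite ler_weXz2l // ltW // prime_base_gt1.
apply: le_trans (ler_wpM2l c0 le) _.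
rewrite invfM mulrCA ler_piMr // ler_pdivrMr ?ltr_wpDl //.
by rewrite mul1r lerDl.
Qed.

End MildSolutions.

Theorem theorem3p1 (R : realType) (p : nat) (p_prime : prime p)
    (mu : {measure set (Qp_borel p R) -> \bar R})
    (mu_haar : normalized_haar mu)
    (alpha gamma u0 : R) (alpha_gt0 : 0 < alpha) (gamma_gt0 : 0 < gamma)
    (f : R -> R -> R) (M F : R)
    (f_bounded : forall t : Qp p, t != 0 ->
      forall x : R, `|f (Qp_norm R t) x| <= M)
    (f_lipschitz : forall t : Qp p, t != 0 -> forall x y : R,
      `|f (Qp_norm R t) x - f (Qp_norm R t) y| <= F * `|x - y|)
    (gamma_lt : gamma < Num.min 1 alpha) :
  exists N0 : int, forall N : int, N <= N0 ->
    exists u : Qp p -> R,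
      mild_solution mu alpha gamma u0 f N u /\
      forall (L : int) (v : Qp p -> R),
        mild_solution mu alpha gamma u0 f L v ->
        exists K : int, [/\ K <= N, K <= L &
          forall t : Qp p, Qp_ball R K t -> v t = u t].
Proof.
have [N0 N0le0 rate] := mild_rate_small p_prime f_lipschitz gamma_lt.
exists N0 => N NN0.
have [u u_sol] := mild_solution_exists p_prime mu_haar u0 gamma_gt0 f_bounded
  f_lipschitz gamma_lt (le_trans NN0 N0le0) (rate N NN0).
exists u; split=> // L v v_sol; exists (Num.min N L).
have KN : Num.min N L <= N by rewrite ge_min lexx.
have KL : Num.min N L <= L by rewrite ge_min lexx orbT.
split=> //; have KN0 := le_trans KN NN0.
apply: (mild_solution_unique p_prime mu_haar gamma_gt0 f_bounded f_lipschitz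
  gamma_lt (le_trans KN0 N0le0) (rate _ KN0)).
  exact: mild_solution_shrink KN u_sol.
exact: mild_solution_shrink KL v_sol.
Qed.
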